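(* Let $p$ be an odd prime, $m,s$ positive integers, and $\mathcal{R}=\mathbb{F}_{p^m}[u,v]/\langle u^2,v^2,uv-vu\rangle$. Let $\alpha=\alpha_1+\alpha_3v+\alpha_4uv\in\mathcal{R}$ with $\alpha_1,\alpha_3,\alpha_4\in\mathbb{F}_{p^m}^*$, and suppose $\alpha$ is not a square in $\mathcal{R}$. Let $\alpha_0\in\mathbb{F}_{p^m}$ be the element with $\alpha_0^{p^s}=\alpha_1$. Let $\mathcal{C}=\langle (x^2-\alpha_0)^\ell+u(x^2-\alpha_0)^tz(x)\rangle$ be the ideal of $\mathcal{R}_\alpha=\mathcal{R}[x]/\langle x^{2p^s}-\alpha\rangle$, where $0\le\ell\le 2p^s-1$, $0\le t<\ell$, and $z(x)$ is $0$ or a unit. Let $\Im$ be the smallest non-negative integer such that $u(x^2-\alpha_0)^{\Im}\in\mathcal{C}$. Then the Hamming distance of $\mathcal{C}$ is $$d_H(\mathcal{C})=\begin{cases}1 & \text{if } 0\le\Im\le p^s;\\ (\Gamma+1)p^{\gamma} & \text{if } 2p^s-p^{s-\gamma}+(\Gamma-1)p^{s-\gamma-1}+1\le\Im\le 2p^s-p^{s-\gamma}+\Gamma p^{s-\gamma-1},\\ & \text{where } 1\le\Gamma\le p-1 \text{ and } 0\le\gamma\le s-1.\end{cases}$$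
   Context: Elements of $\mathcal{R}_\alpha=\mathcal{R}[x]/\langle x^{2p^s}-\alpha\rangle$ are identified with vectors in $\mathcal{R}^{2p^s}$: the class whose representative of degree less than $2p^s$ is $\zeta_0+\zeta_1x+\cdots+\zeta_{2p^s-1}x^{2p^s-1}$ corresponds to $(\zeta_0,\ldots,\zeta_{2p^s-1})$. Ideals of $\mathcal{R}_\alpha$ are thereby the $\alpha$-constacyclic codes of length $2p^s$ over $\mathcal{R}$. The Hamming weight of a vector is the number of its nonzero entries, and the Hamming distance $d_H(\mathcal{C})$ of a nonzero linear code is the minimum Hamming weight of its nonzero codewords. When $z(x)$ is a unit, it is represented as a finite sum $z(x)=\sum_{\kappa}(z_{0\kappa}x+z_{1\kappa})(x^2-\alpha_0)^\kappa$ with $z_{0\kappa},z_{1\kappa}\in\mathbb{F}_{p^m}$ and $z_{00}x+z_{10}\ne0$. *)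

(* Defs.v *)
From mathcomp Require Import all_boot all_order all_algebra.

Set Implicit Arguments.
Unset Strict Implicit.
Unset Printing Implicit Defensive.

Import GRing.Theory.
Import Pdiv.CommonRing Pdiv.RingMonic.
Local Open Scope ring_scope.

(* F[u]/<u^2>. *)
Definition dual_numbers (F : fieldType) := {poly %/ ('X^2 : {poly F})}.

(* F[u,v]/<u^2, v^2, uv - vu>, built as (F[u]/<u^2>)[v]/<v^2>.  The lemmas
   [quotR_surj] and [quotR_ker] below check that this is the quotient of F[u][v]
   by the ideal generated by u^2, v^2 and uv - vu. *)
Definition baseR (F : fieldType) := {poly %/ ('X^2 : {poly (dual_numbers F)})}.

Definition cstR (F : fieldType) (a : F) : baseR F := qpolyC _ (qpolyC _ a).
Definition uR (F : fieldType) : baseR F := qpolyC _ (qpolyX 'X^2).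
Definition vR (F : fieldType) : baseR F := qpolyX 'X^2.

Section Presentation.
Variable F : fieldType.

Definition quotR (P : {poly {poly F}}) : baseR F :=
  in_qpoly 'X^2 (map_poly (in_qpoly 'X^2 : {poly F} -> dual_numbers F) P).

Lemma quotR_zmod_morphism : zmod_morphism quotR.
Proof. by move=> P Q; rewrite /quotR !raddfB. Qed.

Lemma quotR_monoid_morphism : monoid_morphism quotR.
Proof. by split=> [|P Q]; rewrite /quotR ?rmorph1 // !rmorphM. Qed.

Lemma quotR_cst (a : F) : quotR a%:P%:P = cstR a.
Proof.
rewrite /quotR map_polyC /=; apply: val_inj => /=.
rewrite mk_monic_Xn rmodp_small ?size_polyXn ?(leq_ltn_trans (size_polyC_leq1 _)) //.
congr (_%:P); apply: val_inj => /=.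
by rewrite mk_monic_Xn rmodp_small ?size_polyXn ?(leq_ltn_trans (size_polyC_leq1 _)).
Qed.

Lemma quotR_u : quotR 'X%:P = uR F.
Proof.
rewrite /quotR map_polyC /=; apply: val_inj => /=.
by rewrite mk_monic_Xn rmodp_small ?size_polyXn ?(leq_ltn_trans (size_polyC_leq1 _)).
Qed.

Lemma quotR_v : quotR 'X = vR F.
Proof. by rewrite /quotR map_polyX. Qed.

Lemma in_qpolyX2_eq0 (A : comNzRingType) (q : {poly A}) :
  in_qpoly 'X^2 q = 0 <-> exists r, q = r * 'X^2.
Proof.
have X2 : mk_monic ('X^2 : {poly A}) = 'X^2 by rewrite mk_monic_Xn.
split=> [/(congr1 val) /= | [r ->]].
  rewrite X2 => q0; exists (rdivp q 'X^2).
  by rewrite {1}(rdivp_eq (monicXn A 2) q) q0 addr0.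
by apply: val_inj; rewrite /= X2 rmodp_mull ?monicXn.
Qed.

Lemma in_qpolyK (A : comNzRingType) (h : {poly A}) (q : {poly %/ h}) :
  in_qpoly h q = q.
Proof. by apply: val_inj; apply: in_qpoly_small; apply: size_mk_monic. Qed.

Lemma quotR_surj (r : baseR F) : exists P, quotR P = r.
Proof.
exists (map_poly (@polyn _ _ : dual_numbers F -> {poly F}) r).
rewrite /quotR -[RHS]in_qpolyK; congr (in_qpoly _ _).
by apply/polyP=> i; rewrite coef_map coef_map_id0 //; apply: in_qpolyK.
Qed.

Lemma quotR_ker (P : {poly {poly F}}) :
  quotR P = 0 <->
  exists A B C : {poly {poly F}},
    P = A * ('X%:P) ^+ 2 + B * 'X ^+ 2 + C * ('X%:P * 'X - 'X * 'X%:P).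
Proof.
have quotRD : {morph quotR : x y / x + y}.
  by move=> x y; rewrite /quotR !raddfD.
have quotRM : {morph quotR : x y / x * y} by case: quotR_monoid_morphism.
have tail r : in_qpoly ('X^2 : {poly (dual_numbers F)}) (r * 'X^2) = 0.
  by apply/in_qpolyX2_eq0; exists r.
split=> [|[A [B [C ->]]]]; last first.
  rewrite ['X%:P * 'X]mulrC subrr mulr0 addr0 quotRD.
  have -> : quotR (B * 'X ^+ 2) = 0.
    by rewrite /quotR rmorphM /= map_polyXn tail.
  have -> : quotR (A * 'X%:P ^+ 2) = 0.
    rewrite quotRM -(rmorphXn (@polyC {poly F})) {2}/quotR map_polyC /=.
    suff -> : in_qpoly ('X^2 : {poly F}) 'X^2 = 0.
      by rewrite !rmorph0 mulr0.
    by apply/in_qpolyX2_eq0; exists 1; rewrite mul1r.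
  by rewrite addr0.
case/in_qpolyX2_eq0=> r rE.
have low i : (i < 2)%N -> exists q, P`_i = q * 'X^2.
  move=> i2; apply/in_qpolyX2_eq0.
  have := congr1 (fun q : {poly _} => q`_i) rE.
  by rewrite coef_map coefMXn i2.
have [q0 Pq0] := low 0%N isT; have [q1 Pq1] := low 1%N isT.
exists (q0%:P + q1%:P * 'X), (drop_poly 2 P), 0; rewrite mul0r addr0.
rewrite -[P in LHS](poly_take_drop 2); congr (_ + _).
apply/polyP=> -[|[|i]]; rewrite coef_take_poly -(rmorphXn (@polyC {poly F})) coefMC coefD
  coefC coefMX coefC /= ?addr0 ?add0r ?mul0r //.
Qed.

End Presentation.

(* R[x]/<x^n - alpha>; for n > 0 the modulus is monic of positive degree, see
   [mk_monic_constacyclic], so that {poly %/ _} is the genuine quotient. *)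
Definition constacyclic_ring (R : comNzRingType) (n : nat) (alpha : R) :=
  {poly %/ ('X^n - alpha%:P)}.

Lemma mk_monic_constacyclic (R : comNzRingType) (n : nat) (alpha : R) :
  (0 < n)%N -> mk_monic ('X^n - alpha%:P) = 'X^n - alpha%:P.
Proof.
by move=> n0; rewrite /mk_monic size_XnsubC // ltnS n0 monicXnsubC.
Qed.

(* The coefficient vector of the representative of degree less than n. *)
Definition codeword (R : comNzRingType) (n : nat) (alpha : R)
    (c : constacyclic_ring n alpha) : 'rV[R]_n :=
  \row_(i < n) (c : {poly R})`_i.

Definition hamming_weight (R : comNzRingType) (n : nat) (w : 'rV[R]_n) : nat :=
  #|[set i | w 0 i != 0]|.

Definition is_least (P : nat -> Prop) (n : nat) : Prop :=
  P n /\ forall k, P k -> (n <= k)%N.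

Definition principal_ideal (A : comNzRingType) (g f : A) : Prop :=
  exists a, f = a * g.

(* d is the Hamming distance of C; in particular C is nonzero. *)
Definition hamming_distance (R : comNzRingType) (n : nat) (alpha : R)
    (C : constacyclic_ring n alpha -> Prop) (d : nat) : Prop :=
  is_least (fun k => exists c, [/\ C c, c != 0 &
                                   hamming_weight (codeword c) = k]) d.

Section Elements.
Variables (F : fieldType) (n : nat) (alpha : baseR F).

Definition cstA (a : F) : constacyclic_ring n alpha := qpolyC _ (cstR a).
Definition uA : constacyclic_ring n alpha := qpolyC _ (uR F).
Definition xA : constacyclic_ring n alpha := qpolyX _.

(* x^2 - alpha0 *)
Definition yA (alpha0 : F) : constacyclic_ring n alpha := xA ^+ 2 - cstA alpha0.

(* A unit z comes in the normal form
   \sum_k (z0_k x + z1_k) (x^2 - alpha0)^k with coefficients in F. *)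
Definition zero_or_unit (alpha0 : F) (z : constacyclic_ring n alpha) : Prop :=
  z = 0 \/
  (exists w, z * w = 1) /\
  exists (N : nat) (z0 z1 : nat -> F),
    z0 0%N *: 'X + (z1 0%N)%:P != 0 :> {poly F} /\
    z = \sum_(k < N.+1) (cstA (z0 k) * xA + cstA (z1 k)) * yA alpha0 ^+ k.

End Elements.

Arguments cstA {F} n alpha a.
Arguments uA {F} n alpha.
Arguments xA {F} n alpha.
Arguments yA {F} n alpha alpha0.

(* Main.v *)
Require Import Defs.
From HB Require Import structures.
From mathcomp Require Import all_boot all_order all_algebra all_field.
From mathcomp Require Import zify ring.

(* Let N = p^s and y = x^2 - alpha0. Since y^N = v (alpha3 + alpha4 u), we have
   u y^N = alpha3 u v and u y^(2N) = 0.

   Lower bound: the socle of the base ring is F u v, so multiplying a nonzero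
   codeword by u or v when this does not kill it yields a nonzero codeword
   u v d(x) of no larger weight, with d over F of degree less than 2N. Then
   u y^N d(x) is in C, and as X^2 - alpha0 is irreducible over F, Bezout
   inverts the part of d prime to it modulo y^(2N): hence (X^2 - alpha0)^(I - N)
   divides d. Splitting d into even and odd parts, it remains to bound the weight
   of a nonzero multiple g of (X - a)^i of degree less than p^s. If j is the exact
   multiplicity of a in g, the weight of g is at least the product of the
   (digit + 1) over the base p digits of j: writing j = p j' + j0 and grouping
   exponents modulo p, at least j0 + 1 of the p components of g have exact
   multiplicity j' at a^p.

   Upper bound: u y^(N + e) = alpha3 u v y^e, and for
   e = p^n Gam + p^(n+1) (p^gam - 1), n = s - gam - 1, Frobenius factors
   (X^2 - alpha0)^e into polynomials in X^(2 p^n) and X^(2 p^(n+1)) with at most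
   Gam + 1 and p^gam terms. *)

Set Implicit Arguments.
Unset Strict Implicit.
Unset Printing Implicit Defensive.

Import GRing.Theory Pdiv.CommonRing Pdiv.RingMonic.
Local Open Scope ring_scope.

(** * Weight of a polynomial *)

Section PolyWeight.
Variable A : nzRingType.
Implicit Types g h : {poly A}.

Definition poly_wt g : nat := (\sum_(i < size g) (g`_i != 0)%R)%N.

Lemma poly_wtE n g : (size g <= n)%N -> poly_wt g = (\sum_(i < n) (g`_i != 0)%R)%N.
Proof.
move=> le_gn; rewrite /poly_wt (big_ord_widen n (fun i => nat_of_bool (g`_i != 0))) //.
rewrite big_mkcond; apply: eq_bigr => i _.
by case: ltnP => // /leq_sizeP/(_ _ (leqnn _)) ->; rewrite eqxx.
Qed.

Lemma poly_wt_gt0 g : g != 0 -> (0 < poly_wt g)%N.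
Proof.
rewrite -lead_coef_eq0 lead_coefE /poly_wt.
case E: (size g) => [|n] gn0; last by rewrite big_ord_recr /= gn0 addn1.
by rewrite nth_default ?E ?eqxx in gn0.
Qed.

Lemma leq_poly_wt_size g n : (size g <= n)%N -> (poly_wt g <= n)%N.
Proof.
move=> /poly_wtE ->; rewrite -[leqRHS](card_ord n) -sum1_card.
by apply: leq_sum => i _; case: eqP.
Qed.

(** Component of [g] for the grouping of exponents modulo [d]. The length [size g] is generous: for
    [d > 0] no nonzero coefficient is lost. *)
Definition poly_res d r g := \poly_(i < size g) g`_(d * i + r).

Lemma coef_poly_res d r g i : (0 < d)%N -> (poly_res d r g)`_i = g`_(d * i + r).
Proof.
move=> d0; rewrite coef_poly; case: ltnP => // le_gi.
by rewrite nth_default // (leq_trans le_gi); nia.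
Qed.

Lemma size_poly_res d r g n :
  (0 < d)%N -> (size g <= d * n)%N -> (size (poly_res d r g) <= n)%N.
Proof.
move=> d0 le_gn; apply/leq_sizeP => i le_ni.
by rewrite coef_poly_res // nth_default // (leq_trans le_gn); nia.
Qed.

(** Only the summand [k = r] meets exponents congruent to [r] modulo [d], so the decomposition into
    components is unique. *)
Lemma coef_sum_res d (a : 'I_d -> {poly A}) i (r : 'I_d) :
  (\sum_(k < d) (a k \Po 'X^d) * 'X^k)`_(d * i + r) = (a r)`_i.
Proof.
have d0 : (0 < d)%N := leq_ltn_trans (leq0n r) (ltn_ord r).
rewrite coef_sum (bigD1 r) //= coefMXn ltnNge leq_addl /= addnK.
rewrite coef_comp_poly_Xn // dvdn_mulr // mulKn // big1 ?addr0 // => k neq_kr.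
rewrite coefMXn; case: ltnP => // le_k; rewrite coef_comp_poly_Xn //.
case: ifP => // dvd_d; case/eqP: neq_kr; apply/val_inj => /=.
have: d * i + r = k %[mod d].
  by apply/eqP; rewrite eqn_mod_dvd.
by rewrite mulnC modnMDl !modn_small.
Qed.

Lemma poly_res_sum d (a : 'I_d -> {poly A}) (r : 'I_d) :
  poly_res d r (\sum_(k < d) (a k \Po 'X^d) * 'X^k) = a r.
Proof.
have d0 : (0 < d)%N := leq_ltn_trans (leq0n r) (ltn_ord r).
by apply/polyP => i; rewrite coef_poly_res // coef_sum_res.
Qed.

Lemma sum_poly_res d g : (0 < d)%N ->
  g = \sum_(k < d) (poly_res d k g \Po 'X^d) * 'X^k.
Proof.
move=> d0; apply/polyP => n.
have lt_nd : (n %% d < d)%N by rewrite ltn_pmod.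
rewrite {2}(divn_eq n d) mulnC (coef_sum_res _ _ (Ordinal lt_nd)) /=.
by rewrite coef_poly_res // mulnC -divn_eq.
Qed.

Lemma poly_wt_res d g : (0 < d)%N ->
  poly_wt g = (\sum_(r < d) poly_wt (poly_res d r g))%N.
Proof.
(* Padding to [d * size g] coefficients cuts the sum into blocks of length [d], each with one
   exponent of every residue. *)
move=> d0; have le_g : (size g <= d * size g)%N by nia.
rewrite (poly_wtE le_g).
under [RHS]eq_bigr do rewrite (poly_wtE (size_poly_res _ d0 le_g)).
elim: (size g) => [|n IHn].
  by rewrite muln0 big_ord0 big1 // => r _; rewrite big_ord0.
under [RHS]eq_bigr do rewrite big_ord_recr /=.
rewrite big_split /= -IHn mulnS addnC big_split_ord /=; congr addn.
by apply: eq_bigr => r _; rewrite coef_poly_res.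
Qed.

End PolyWeight.

Section PolyWeightMul.
Variable A : comNzRingType.
Implicit Types g h : {poly A}.

(** Polynomials form a free module over the polynomials in ['X^d], and taking components is linear
    for this structure. *)
Lemma poly_res_comp_mul d (q h : {poly A}) (r : 'I_d) :
  poly_res d r ((q \Po 'X^d) * h) = q * poly_res d r h.
Proof.
have d0 : (0 < d)%N := leq_ltn_trans (leq0n r) (ltn_ord r).
rewrite {1}(sum_poly_res h d0) big_distrr /=.
under eq_bigr do rewrite mulrA -comp_polyM.
exact: (poly_res_sum (fun k => q * poly_res d k h)).
Qed.

End PolyWeightMul.

(** * Weight of a polynomial with a repeated root *)

(** Product of digit plus one over the [s] lowest base [p] digits of [i]. By Lucas, for [i < p ^ s]
    this is the weight of [('X - a) ^+ i] in characteristic [p], for [a != 0]. *)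
Fixpoint digit_wt (p s i : nat) : nat :=
  if s is s'.+1 then ((i %% p).+1 * digit_wt p s' (i %/ p))%N else 1.

Section RepeatedRoot.
Variables (F : fieldType) (p : nat).
Hypothesis pcharF : p \in [pchar F].
Implicit Types (g h : {poly F}) (a : F).

Let p_gt0 : (0 < p)%N := prime_gt0 (pcharf_prime pcharF).

Lemma exp_pchar_sub (A : comNzRingType) (x y : A) n :
  p \in [pchar A] -> (x - y) ^+ (p ^ n) = x ^+ (p ^ n) - y ^+ (p ^ n).
Proof.
move=> pcharA; elim: n => [|n IHn]; first by rewrite !expr1.
by rewrite expnSr !exprM IHn -!(pFrobenius_autE pcharA) rmorphB.
Qed.

(** Induction on [n]: with [e] the degree of [g], the operator [X d/dX - e] lowers the weight by
    exactly one and the multiplicity at [a] by at most one. As [e < p], the exponents stay distinct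
    in [F]. *)
Lemma poly_wt_root_lt_pchar g a n :
  g != 0 -> (size g <= p)%N -> a != 0 -> ('X - a%:P) ^+ n %| g ->
  (n < poly_wt g)%N.
Proof.
move=> + + a0; elim: n g => [|n IHn] g g0 le_gp; first by rewrite poly_wt_gt0.
case/dvdpP=> q gE.
have sg : (0 < size g)%N by rewrite size_poly_gt0.
pose e := (size g).-1; have eE : size g = e.+1 by rewrite prednK.
(* This operator kills the leading coefficient and no other one. *)
pose h := 'X * g^`() - e%:R *: g.
have hE j : h`_j = (j%:R - e%:R) * g`_j.
  rewrite coefB coefXM coefZ coef_deriv mulrBl; congr (_ - _).
  by case: j => [|j] /=; rewrite ?mul0r ?mulr_natl.
have le_hg : (size h <= size g)%N.
  by apply/leq_sizeP => j le_j; rewrite hE nth_default // mulr0.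
(* Otherwise [g] would be a monomial, whose only possible root is 0. *)
have h0 : h != 0.
  apply/eqP => hz.
  have gX : g = g`_e *: 'X^e.
    apply/polyP => j; rewrite coefZ coefXn.
    have [->|neq_je] := eqVneq; first by rewrite mulr1.
    rewrite mulr0; have [le_gj|lt_jg] := leqP (size g) j.
      by rewrite nth_default.
    have /eqP := hE j; rewrite hz coef0 eq_sym mulf_eq0 => /orP[|/eqP //].
    rewrite subr_eq0 => /eqP eq_je; case/eqP: neq_je.
    have lt_je : (j <= e)%N by lia.
    move/esym/eqP: eq_je; rewrite -subr_eq0 -natrB // -(dvdn_pcharf pcharF).
    by move=> /dvdn_leq; lia.
  have : root g a by rewrite gE exprS mulrCA rootM root_XsubC eqxx.
  rewrite gX rootE hornerZ hornerXn mulf_eq0 expf_eq0 (negbTE a0) andbF orbF.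
  by rewrite -lead_coefE lead_coef_eq0 (negbTE g0).
have : ('X - a%:P) ^+ n %| h.
  rewrite /h gE derivM deriv_exp /= derivB derivX derivC subr0 mul1r.
  rewrite !exprS; apply: dvdp_sub; last by rewrite -mul_polyC !mulrA dvdp_mull.
  rewrite dvdp_mull // dvdp_add //; first by rewrite mulrA dvdp_mull.
  by rewrite mulrnAr -mulrnAl dvdp_mull.
move=> /(IHn h h0 (leq_trans le_hg le_gp)) /leq_ltn_trans; apply.
rewrite (poly_wtE (leqnn (size g))) (poly_wtE le_hg) eE !big_ord_recr /=.
rewrite hE subrr mul0r eqxx addn0 -lead_coefE lead_coef_eq0 g0 addn1 ltnS.
by apply: leq_sum => i _; rewrite hE mulf_eq0; case: (g`_i == 0); rewrite ?orbT ?leq_b1.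
Qed.

(** Induction on [s], passing from [i] and [a] to [i %/ p] and [a ^+ p]. The factor with exponent a
    multiple of [p] is a polynomial in ['X^p], so it multiplies every component of the remaining
    factor [k]. *)
Lemma digit_wt_le_poly_wt s i h a :
  a != 0 -> ~~ root h a -> (digit_wt p s i <= poly_wt (('X - a%:P) ^+ i * h))%N.
Proof.
elim: s i h a => [|s IHs] i h a a0 ha.
  rewrite poly_wt_gt0 // mulf_neq0 ?expf_neq0 ?polyXsubC_eq0 //.
  by apply: contraNneq ha => ->; rewrite root0.
have pcharP : p \in [pchar {poly F}] by rewrite pchar_poly.
have XpE : 'X^p - (a ^+ p)%:P = ('X - a%:P) ^+ p.
  by rewrite -[p]expn1 exp_pchar_sub // rmorphXn.
pose k := ('X - a%:P) ^+ (i %% p) * h.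
have gE : ('X - a%:P) ^+ i * h =
    (('X - (a ^+ p)%:P) ^+ (i %/ p) \Po 'X^p) * k.
  rewrite rmorphXn /= comp_polyB comp_polyX comp_polyC XpE -exprM mulrA -exprD.
  by rewrite mulnC -divn_eq.
rewrite gE (poly_wt_res _ p_gt0).
under eq_bigr do rewrite poly_res_comp_mul.
(* Reducing k modulo 'X^p - a^p amounts to evaluating its components. *)
pose K := \poly_(r < p) (poly_res p r k).[a ^+ p].
have dvd_kK : ('X - a%:P) ^+ p %| k - K.
  rewrite {1}(sum_poly_res k p_gt0) /K poly_def -sumrB -XpE.
  apply: (big_ind (fun q => _ %| q)) => [|u v|r _]; [exact: dvdp0 | exact: dvdp_add |].
  rewrite -mul_polyC -mulrBl dvdp_mulr //.
  set q := poly_res p r k.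
  have := @dvdp_comp_poly _ 'X^p ('X - (a ^+ p)%:P) (q - (q.[a ^+ p])%:P).
  rewrite !comp_polyB !comp_polyC comp_polyX; apply.
  by rewrite dvdp_XsubCl rootE !hornerE subrr.
have lt_ip : (i %% p < p)%N by rewrite ltn_pmod.
have dvd_K : ('X - a%:P) ^+ (i %% p) %| K.
  rewrite -(dvdp_subr _ (dvdp_mulr h (dvdpp _))) -/k.
  exact: dvdp_trans (dvdp_exp2l _ (ltnW lt_ip)) dvd_kK.
(* If [K = 0], then [('X - a) ^+ p] divides [k]; cancelling [i %% p] factors leaves a positive power
   dividing [h]. *)
have K0 : K != 0.
  apply: contraNneq ha => K0; move: dvd_kK; rewrite K0 subr0 /k.
  rewrite -[X in _ ^+ X %| _](subnKC (ltnW lt_ip)) exprD.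
  rewrite dvdp_mul2l ?expf_neq0 ?polyXsubC_eq0 //.
  rewrite -dvdp_XsubCl; apply: dvdp_trans; apply: dvdp_exp => //.
  by rewrite subn_gt0.
(* The weight of [K] counts the components of [k] not vanishing at [a ^+ p]; the induction
   hypothesis applies to each of them. *)
have := poly_wt_root_lt_pchar K0 (size_poly _ _) a0 dvd_K.
rewrite (poly_wtE (size_poly _ _)) => wtK.
apply: leq_trans (leq_mul wtK (leqnn (digit_wt p s (i %/ p)))) _.
rewrite big_distrl /=; apply: leq_sum => r _; rewrite coef_poly ltn_ord.
case: eqP => [//|/eqP kr0]; rewrite mul1n IHs ?expf_neq0 //.
Qed.

(** [digit_wt] is not monotone in its last argument, so the bound is stated at the exact
    multiplicity [j] of [a] in [g]. *)
Lemma poly_wt_ge_digit_wt s i g a :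
  g != 0 -> (size g <= p ^ s)%N -> a != 0 -> ('X - a%:P) ^+ i %| g ->
  exists2 j, (i <= j < p ^ s)%N & (digit_wt p s j <= poly_wt g)%N.
Proof.
move=> g0 le_g a0 dvd_g; have [j [h]] := multiplicity_XsubC g a.
rewrite g0 /= => ha gE; rewrite mulrC in gE.
have h0 : h != 0 by apply: contraNneq ha => ->; rewrite root0.
exists j; last by rewrite gE digit_wt_le_poly_wt.
apply/andP; split.
  rewrite leqNgt; apply: contraNN ha => lt_ji.
  rewrite -dvdp_XsubCl; move: dvd_g.
  rewrite gE -(subnKC (ltnW lt_ji)) exprD dvdp_mul2l ?expf_neq0 ?polyXsubC_eq0 //.
  by apply: dvdp_trans; rewrite dvdp_exp // subn_gt0.
apply: leq_trans le_g; rewrite gE size_mul ?expf_neq0 ?polyXsubC_eq0 //.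
by rewrite size_exp_XsubC addSn /= -[ltnLHS]addn0 ltn_add2l size_poly_gt0.
Qed.

End RepeatedRoot.

(** * Lower bounds on the digit weight *)

Section DigitWeight.
Variable p : nat.
Hypothesis p_gt0 : (0 < p)%N.

Lemma digit_wt_pred_exp c : digit_wt p c (p ^ c).-1 = (p ^ c)%N.
Proof.
elim: c => //= c IHc.
have pc_gt0 : (0 < p ^ c)%N by rewrite expn_gt0 p_gt0.
have -> : (p ^ c.+1).-1 = ((p ^ c).-1 * p + p.-1)%N by rewrite expnS; nia.
by rewrite modnMDl divnMDl // modn_small ?divn_small ?ltn_predL // addn0 IHc
  prednK // expnS.
Qed.

(** All digits but the lowest equal [p - 1], and the lowest is at least [k]. *)
Lemma digit_wt_top c i k :
  (p ^ c.+1 + k <= i + p)%N -> (i < p ^ c.+1)%N ->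
  (k.+1 * p ^ c <= digit_wt p c.+1 i)%N.
Proof.
rewrite expnS => ge_i lt_i /=.
have pc_gt0 : (0 < p ^ c)%N by rewrite expn_gt0 p_gt0.
have iE := divn_eq i p; have lt_ip : (i %% p < p)%N by rewrite ltn_pmod.
have qE : (i %/ p)%N = (p ^ c).-1 by nia.
rewrite qE digit_wt_pred_exp leq_mul2r ltnS; apply/orP; right.
by move: iE; rewrite qE -subn1 mulnBl; nia.
Qed.

(** The top [c] digits equal [p - 1] and the next one is at least [k]; the induction drops the [n]
    digits below. *)
Lemma digit_wt_ge n c i k :
  (p ^ (c + n).+1 + k * p ^ n <= i + p ^ n.+1)%N -> (i < p ^ (c + n).+1)%N ->
  (k.+1 * p ^ c <= digit_wt p (c + n).+1 i)%N.
Proof.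
elim: n i => [|n IHn] i.
  by rewrite addn0 expn0 muln1 expn1; apply: digit_wt_top.
rewrite addnS => ge_i lt_i.
have iE := divn_eq i p; have lt_ip : (i %% p < p)%N by rewrite ltn_pmod.
apply: leq_trans (leq_pmull _ (ltn0Sn (i %% p))).
by apply: IHn; move: ge_i lt_i;
  rewrite (expnS _ (c + n).+1) (expnS _ n.+1) (expnS _ n); nia.
Qed.

(** Beyond the threshold, either the digit of rank [n] exceeds [k], or a lower digit is nonzero and
    doubles the product, where [2 (k + 1) >= k + 2]. *)
Lemma digit_wt_gt n c i k :
  (p ^ (c + n).+1 + k * p ^ n < i + p ^ n.+1)%N -> (i < p ^ (c + n).+1)%N ->
  (k.+2 * p ^ c <= digit_wt p (c + n).+1 i)%N.
Proof.
elim: n i => [|n IHn] i.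
  rewrite addn0 expn0 muln1 expn1 => ge_i; apply: digit_wt_top; lia.
rewrite addnS => ge_i lt_i.
have iE := divn_eq i p; have lt_ip : (i %% p < p)%N by rewrite ltn_pmod.
have lt_j : (i %/ p < p ^ (c + n).+1)%N.
  by rewrite ltn_divLR // -expnSr.
have [lt_j'|le_j] := ltnP (p ^ (c + n).+1 + k * p ^ n) (i %/ p + p ^ n.+1).
  exact: leq_trans (IHn _ lt_j' lt_j) (leq_pmull _ (ltn0Sn (i %% p))).
(* With [le_j], this puts [i %/ p] exactly at the threshold, so the strictness comes from the lowest
   digit of [i]. *)
have ge_j : (p ^ (c + n).+1 + k * p ^ n <= i %/ p + p ^ n.+1)%N.
  by move: ge_i lt_i; rewrite (expnS _ (c + n).+1) (expnS _ n.+1) (expnS _ n); nia.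
have i0_gt0 : (0 < i %% p)%N.
  by move: ge_i lt_i le_j; rewrite (expnS _ (c + n).+1) (expnS _ n.+1) (expnS _ n); nia.
have := digit_wt_ge ge_j lt_j.
change (digit_wt p (c + n).+2 i) with ((i %% p).+1 * digit_wt p (c + n).+1 (i %/ p))%N.
nia.
Qed.

End DigitWeight.

(** * Upper bounds on weights of sums, products and substitutions *)

Section WeightUpper.
Variable A : nzRingType.
Implicit Types g h : {poly A}.

Lemma leq_poly_wtD g h : (poly_wt (g + h) <= poly_wt g + poly_wt h)%N.
Proof.
pose n := maxn (size g) (size h).
rewrite (poly_wtE (size_polyD g h)) -/n (poly_wtE (leq_maxl _ _ : size g <= n)%N).
rewrite (poly_wtE (leq_maxr _ _ : size h <= n)%N) -big_split /=.
apply: leq_sum => i _; rewrite coefD.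
by case: eqP => //; case: (g`_i =P 0) => //= ->; rewrite add0r => /eqP ->.
Qed.

Lemma leq_poly_wt_sum I (r : seq I) (P : pred I) (f : I -> {poly A}) :
  (poly_wt (\sum_(i <- r | P i) f i) <= \sum_(i <- r | P i) poly_wt (f i))%N.
Proof.
apply: (big_ind2 (fun g n => poly_wt g <= n)%N) => // [|g n h m le_g le_h].
  by rewrite /poly_wt size_poly0 big_ord0.
exact: leq_trans (leq_poly_wtD g h) (leq_add le_g le_h).
Qed.

Lemma leq_poly_wt_scaleXn (a : A) n h :
  (poly_wt (a *: 'X^n * h) <= (a != 0%R) * poly_wt h)%N.
Proof.
have -> : a *: 'X^n * h = a *: h * 'X^n by rewrite -!scalerAl commr_polyXn.
have le_s : (size (a *: h * 'X^n)%R <= n + size h)%N.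
  apply/leq_sizeP => i le_i; rewrite coefMXn; case: ltnP => // le_ni.
  by rewrite coefZ [h`__]nth_default ?mulr0 // leq_subRL.
rewrite (poly_wtE le_s) big_split_ord /= big1 ?add0n => [|i _]; last first.
  by rewrite coefMXn ltn_ord eqxx.
rewrite /poly_wt big_distrr /=; apply: leq_sum => i _.
rewrite coefMXn ltnNge leq_addr addKn coefZ.
by case: (a =P 0) => [->|_]; case: (h`_i =P 0) => [->|_];
  rewrite ?mul0r ?mulr0 ?eqxx ?leq_b1.
Qed.

Lemma leq_poly_wtM g h : (poly_wt (g * h) <= poly_wt g * poly_wt h)%N.
Proof.
rewrite -[g in X in (X <= _)%N]coefK poly_def big_distrl /=.
apply: leq_trans (leq_poly_wt_sum _ _ _) _; rewrite big_distrl /=.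
by apply: leq_sum => i _; apply: leq_poly_wt_scaleXn.
Qed.

Lemma leq_poly_wt_comp_Xn g d : (poly_wt (g \Po 'X^d) <= poly_wt g)%N.
Proof.
rewrite comp_polyE; apply: leq_trans (leq_poly_wt_sum _ _ _) _.
apply: leq_sum => i _; rewrite -exprM.
rewrite -[_ *: _]mulr1; apply: leq_trans (leq_poly_wt_scaleXn _ _ _) _.
by rewrite -[leqRHS]muln1 leq_mul2l leq_poly_wt_size ?orbT // size_poly1.
Qed.

End WeightUpper.

(** * Weights of multiples and powers of [X^2 - a] *)

Section QuadraticPower.
Variables (F : fieldType) (p : nat).
Hypothesis pcharF : p \in [pchar F].
Variable a : F.

Let p_gt0 : (0 < p)%N := prime_gt0 (pcharf_prime pcharF).

(** The divisor is a polynomial in ['X^2], so [('X - a) ^+ i] divides both the even and the odd part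
    of [g]; a nonzero one already has the required weight. *)
Lemma poly_wt_quadratic_ge n c k i (g : {poly F}) :
  a != 0 -> g != 0 -> (size g <= 2 * p ^ (c + n).+1)%N ->
  ('X^2 - a%:P) ^+ i %| g ->
  (p ^ (c + n).+1 + k * p ^ n < i + p ^ n.+1)%N ->
  (k.+2 * p ^ c <= poly_wt g)%N.
Proof.
move=> a0 g0 le_g /dvdpP[q]; rewrite mulrC => gE lt_i.
have XE : ('X^2 - a%:P) ^+ i = ('X - a%:P) ^+ i \Po 'X^2.
  by rewrite rmorphXn /= comp_polyB comp_polyX comp_polyC.
rewrite (poly_wt_res g (ltn0Sn 1)).
have [/existsP[r gr0]|] := boolP [exists r : 'I_2, poly_res 2 r g != 0].
  rewrite (bigD1 r) //=; apply: leq_trans (leq_addr _ _).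
  have dvd_r : ('X - a%:P) ^+ i %| poly_res 2 r g.
    by rewrite gE XE poly_res_comp_mul dvdp_mulr.
  have le_r := size_poly_res r (ltn0Sn 1) le_g.
  have [j /andP[le_ij lt_j]] := poly_wt_ge_digit_wt pcharF gr0 le_r a0 dvd_r.
  by apply: leq_trans; apply: digit_wt_gt => //;
    apply: leq_trans lt_i _; rewrite leq_add2r.
rewrite negb_exists => /forallP g00; case/eqP: g0.
rewrite (sum_poly_res g (ltn0Sn 1)) big1 // => r _.
by have := g00 r; rewrite negbK => /eqP ->; rewrite comp_poly0 mul0r.
Qed.

Lemma poly_wt_quadratic_le n c k e :
  (e + p ^ n.+1 = p ^ (c + n).+1 + k * p ^ n)%N ->
  (poly_wt (('X^2 - a%:P) ^+ e) <= k.+1 * p ^ c)%N.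
Proof.
move=> eE.
have pc_gt0 : (0 < p ^ c)%N by rewrite expn_gt0 p_gt0.
have {eE} -> : e = (p ^ n * k + p ^ n.+1 * (p ^ c).-1)%N.
  by move: eE; rewrite expnS expnS expnD; nia.
have pcharP : p \in [pchar {poly F}] by rewrite pchar_poly.
have XE j m : ('X^2 - a%:P) ^+ (p ^ j * m) =
    ('X - (a ^+ (p ^ j))%:P) ^+ m \Po 'X^(2 * p ^ j).
  rewrite exprM exp_pchar_sub // rmorphXn /= comp_polyB comp_polyX comp_polyC.
  by rewrite rmorphXn exprM.
rewrite exprD !XE; apply: leq_trans (leq_poly_wtM _ _) _.
apply: leq_mul; apply: leq_trans (leq_poly_wt_comp_Xn _ _) _.
  by rewrite leq_poly_wt_size ?size_exp_XsubC.
by rewrite leq_poly_wt_size ?size_exp_XsubC ?prednK.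
Qed.

End QuadraticPower.

(** * Nilpotent extensions and constacyclic rings *)

Section DualNumbers.
Variable A : comNzRingType.
Local Notation D := {poly %/ ('X^2 : {poly A})}.
Local Notation eps := (qpolyX ('X^2 : {poly A})).

Lemma qpolyX2_sqr : eps ^+ 2 = 0.
Proof.
rewrite /qpolyX -rmorphXn; apply/in_qpolyX2_eq0.
by exists 1; rewrite mul1r.
Qed.

Lemma in_qpolyC (h : {poly A}) (a : A) : in_qpoly h a%:P = qpolyC h a.
Proof. by rewrite -[RHS]in_qpolyK. Qed.

Lemma qpolyX2_mulC_eq0 (a : A) : qpolyC 'X^2 a * eps = 0 -> a = 0.
Proof.
rewrite -in_qpolyC /qpolyX -rmorphM => /in_qpolyX2_eq0[r /(congr1 (coefp 1))].
by rewrite /= coefMX coefMXn coefC.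
Qed.

Lemma qpolyX2E (q : D) : q = qpolyC _ q`_0 + qpolyC _ q`_1 * eps.
Proof.
rewrite -!in_qpolyC /qpolyX -rmorphM -rmorphD -[LHS]in_qpolyK.
congr (in_qpoly _ _); apply/polyP => i.
have le_q : (size q <= 2)%N.
  by rewrite -ltnS; apply: leq_trans (size_mk_monic q) _;
    rewrite mk_monic_Xn size_polyXn.
rewrite coefD coefC coefMX coefC.
by case: i => [|[|i]] /=; rewrite ?addr0 ?add0r // nth_default // (leq_trans le_q).
Qed.

(** For [q = q0 + q1 eps] the product [eps * q] is [q0 eps], so it vanishes only if [q0 = 0]. *)
Lemma qpolyX2_ann (q : D) : eps * q = 0 -> q = qpolyC _ q`_1 * eps.
Proof.
rewrite {1 2}(qpolyX2E q) mulrDr mulrCA -expr2 qpolyX2_sqr mulr0 addr0 mulrC.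
by move=> /qpolyX2_mulC_eq0 ->; rewrite qpolyC0 add0r.
Qed.

End DualNumbers.

(** * The base ring and its socle *)

Section BaseRing.
Variable F : fieldType.
Local Notation R := (baseR F).
Local Notation u := (uR F).
Local Notation v := (vR F).

Lemma cstR_zmod_morphism : zmod_morphism (@cstR F).
Proof. by move=> a b; rewrite /cstR !(qpolyCD, qpolyCN). Qed.

Lemma cstR_monoid_morphism : monoid_morphism (@cstR F).
Proof. by split=> [|a b]; rewrite /cstR ?qpolyCM. Qed.

HB.instance Definition _ :=
  GRing.isZmodMorphism.Build F R (@cstR F) cstR_zmod_morphism.
HB.instance Definition _ :=
  GRing.isMonoidMorphism.Build F R (@cstR F) cstR_monoid_morphism.

Lemma uR_sqr : u ^+ 2 = 0.
Proof.
rewrite [u ^+ 2]expr2 /uR -qpolyCM -[_ * _](expr2 (qpolyX _)).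
by rewrite qpolyX2_sqr qpolyC0.
Qed.

Lemma vR_sqr : v ^+ 2 = 0. Proof. exact: qpolyX2_sqr. Qed.

Lemma uvR_mulC_eq0 (a : F) : cstR a * (u * v) = 0 -> a = 0.
Proof.
rewrite mulrA /cstR /uR -qpolyCM => /qpolyX2_mulC_eq0.
exact: qpolyX2_mulC_eq0.
Qed.

(** The coefficient of [u v]: the outer variable of [baseR] is [v], the inner one [u]. *)
Definition socle_coef (r : R) : F := (r`_1 : dual_numbers F)`_1.

(** Two annihilator computations: [v r = 0] gives [r = b v] with [b] a dual number, then [u b v = 0]
    forces [u b = 0], hence [b] is a multiple of [u]. *)
Lemma socleE (r : R) : u * r = 0 -> v * r = 0 -> r = cstR (socle_coef r) * (u * v).
Proof.
move=> ur0 /qpolyX2_ann rE.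
have /qpolyX2_ann bE : qpolyX _ * r`_1 = 0.
  by apply: qpolyX2_mulC_eq0; rewrite qpolyCM -mulrA -rE.
by rewrite {1}rE {1}bE qpolyCM -mulrA.
Qed.

End BaseRing.

(** Two coefficient rings are allowed so that codewords can be compared with polynomials over
    [F]. *)
Lemma poly_wt_leq (A B : nzRingType) (g : {poly A}) (h : {poly B}) :
  (forall i, h`_i = 0 -> g`_i = 0) -> (poly_wt g <= poly_wt h)%N.
Proof.
move=> hg; pose n := maxn (size g) (size h).
rewrite (poly_wtE (leq_maxl _ _ : size g <= n)%N).
rewrite (poly_wtE (leq_maxr _ _ : size h <= n)%N).
apply: leq_sum => i _; case: (h`_i =P 0) => [/hg -> | _]; first by rewrite eqxx.
exact: leq_b1.
Qed.

Section Constacyclic.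
Variables (A : comNzRingType) (n : nat) (alpha : A).
Hypothesis n_gt0 : (0 < n)%N.
Local Notation Q := (constacyclic_ring n alpha).

Lemma size_constacyclic (c : Q) : (size c <= n)%N.
Proof.
rewrite -ltnS; apply: leq_trans (size_mk_monic c) _.
by rewrite mk_monic_constacyclic // size_XnsubC.
Qed.

Lemma hamming_weight_codeword (c : Q) :
  hamming_weight (codeword c) = poly_wt (c : {poly A}).
Proof.
rewrite (poly_wtE (size_constacyclic c)) /hamming_weight cardsE -sum1_card.
rewrite big_mkcond; apply: eq_bigr => i _.
by rewrite !unfold_in /= mxE; case: eqP.
Qed.

(** Scaling does not raise the degree, so no reduction modulo [h] takes place. *)
Lemma poly_qpolyC_mul (h : {poly A}) (r : A) (c : {poly %/ h}) :
  qpolyC _ r * c = r *: (c : {poly A}) :> {poly A}.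
Proof.
rewrite poly_of_qpolyM qpolyCE mul_polyC rmodp_small //.
exact: leq_ltn_trans (size_scale_leq _ _) (size_mk_monic c).
Qed.

Lemma qpolyX_constacyclic : (qpolyX _ : Q) ^+ n = qpolyC _ alpha.
Proof.
rewrite /qpolyX -rmorphXn -in_qpolyC; apply/eqP; rewrite -subr_eq0 -raddfB.
apply/eqP/val_inj; rewrite /= mk_monic_constacyclic //.
by rewrite -[X in rmodp X _]mul1r rmodp_mull // monicXnsubC.
Qed.

End Constacyclic.

(** * Codewords and the socle *)

Lemma irreducible_XnsubC2 (F : fieldType) (a : F) :
  ~ (exists b, b ^+ 2 = a) -> irreducible_poly ('X^2 - a%:P).
Proof.
move=> nsq; apply: cubic_irreducible; first by rewrite size_XnsubC.
move=> b; apply/negP; rewrite rootE !hornerE subr_eq0 => /eqP ba.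
by apply: nsq; exists b; rewrite -ba.
Qed.

Lemma irreducible_factor_out (F : fieldType) (P d : {poly F}) :
  irreducible_poly P -> d != 0 ->
  exists j e, d = P ^+ j * e /\ coprimep e P.
Proof.
move=> irrP; have [m] := ubnP (size d); elim: m d => // m IHm d le_d d0.
have [/dvdpP[q dE]|] := boolP (P %| d); last first.
  rewrite -irreducible_poly_coprime // coprimep_sym => cop.
  by exists 0%N, d; rewrite mul1r.
have [q0 P0] : q != 0 /\ P != 0.
  by apply/norP; rewrite -mulf_eq0 -dE.
have [|j [e [qE cop]]] := IHm q _ q0.
  rewrite dE size_mul // in le_d; case: irrP => P_gt1 _.
  by rewrite -ltnS; apply: leq_trans le_d; rewrite ltnS -subn1 ltn_subRL addnC
    ltn_add2l.
by exists j.+1, e; rewrite exprS -mulrA -qE mulrC.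
Qed.

Section Eval.
Variables (F : fieldType) (A : comNzRingType) (cst : {rmorphism F -> A}).
Variables (n : nat) (alpha : A).
Hypothesis n_gt1 : (1 < n)%N.
Local Notation Q := (constacyclic_ring n alpha).

Definition evQ (f : {poly F}) : Q := in_qpoly _ (map_poly cst f).

Lemma evQD f g : evQ (f + g) = evQ f + evQ g.
Proof. by rewrite /evQ !rmorphD. Qed.

Lemma evQN f : evQ (- f) = - evQ f.
Proof. by rewrite /evQ !rmorphN. Qed.

Lemma evQM f g : evQ (f * g) = evQ f * evQ g.
Proof. by rewrite /evQ !rmorphM. Qed.

Lemma evQX f k : evQ (f ^+ k) = evQ f ^+ k.
Proof. by rewrite /evQ !rmorphXn. Qed.

Lemma evQ_C (a : F) : evQ a%:P = qpolyC _ (cst a).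
Proof. by rewrite /evQ map_polyC in_qpolyC. Qed.

Lemma evQ_X : evQ 'X = qpolyX _.
Proof. by rewrite /evQ map_polyX. Qed.

Lemma poly_qpolyC_evQ (r : A) (f : {poly F}) : (size f <= n)%N ->
  qpolyC _ r * evQ f = r *: map_poly cst f :> {poly A}.
Proof.
move=> le_f; rewrite poly_qpolyC_mul in_qpoly_small //.
rewrite mk_monic_constacyclic ?(ltnW n_gt1) // size_XnsubC ?(ltnW n_gt1) //.
by rewrite ltnS (leq_trans (size_poly _ _)).
Qed.

End Eval.

(** * The code over a base ring with socle spanned by [u v] *)

Section Code.
Variables (F : fieldType) (p s : nat).
Hypothesis pcharF : p \in [pchar F].
Variables (A : comNzRingType) (cst : {rmorphism F -> A}) (u v : A).
Hypothesis u_sqr : u ^+ 2 = 0.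
Hypothesis v_sqr : v ^+ 2 = 0.
Hypothesis cst_uv_eq0 : forall a, cst a * (u * v) = 0 -> a = 0.
Variable soc : A -> F.
Hypothesis socE : forall r, u * r = 0 -> v * r = 0 -> r = cst (soc r) * (u * v).
Variables alpha0 alpha1 alpha3 alpha4 : F.
Hypothesis alpha3_neq0 : alpha3 != 0.
Hypothesis alpha0E : alpha0 ^+ (p ^ s) = alpha1.
Variable alpha : A.
Hypothesis alphaE : alpha = cst alpha1 + cst alpha3 * v + cst alpha4 * (u * v).
Let N := (p ^ s)%N.
Local Notation Q := (constacyclic_ring (2 * N) alpha).
Local Notation ev := (@evQ F A cst (2 * N) alpha).
Local Notation uQ := (qpolyC _ u : Q).
Local Notation Y := ('X^2 - alpha0%:P).
Let yQ : Q := qpolyX _ ^+ 2 - qpolyC _ (cst alpha0).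

Let p_gt0 : (0 < p)%N := prime_gt0 (pcharf_prime pcharF).
Let N_gt0 : (0 < N)%N. Proof. by rewrite expn_gt0 p_gt0. Qed.
Let n_gt1 : (1 < 2 * N)%N. Proof. by lia. Qed.
Let n_gt0 : (0 < 2 * N)%N := ltnW n_gt1.

Lemma evQ_Y : ev Y = yQ.
Proof. by rewrite evQD evQN evQX evQ_X evQ_C. Qed.

(** By Frobenius [Y ^+ N] is [X^(2N) - alpha1], which becomes [alpha - alpha1] in the quotient. *)
Lemma evQ_YN : ev (Y ^+ N) = qpolyC _ (v * (cst alpha3 + cst alpha4 * u)).
Proof.
have pcharP : p \in [pchar {poly F}] by rewrite pchar_poly.
rewrite exp_pchar_sub // -rmorphXn alpha0E -exprM evQD evQN evQX.
rewrite evQ_X evQ_C qpolyX_constacyclic // -qpolyCN -qpolyCD.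
by congr (qpolyC _ _); rewrite alphaE; ring.
Qed.

Lemma qpolyCu_YN : uQ * ev (Y ^+ N) = qpolyC _ (cst alpha3 * (u * v)).
Proof.
rewrite evQ_YN -qpolyCM; congr (qpolyC _ _).
transitivity (cst alpha3 * (u * v) + cst alpha4 * (u ^+ 2 * v)); first by ring.
by rewrite u_sqr mul0r mulr0 addr0.
Qed.

Lemma qpolyCu_Y2N : uQ * ev (Y ^+ (2 * N)) = 0.
Proof.
have -> : Y ^+ (2 * N) = Y ^+ N * Y ^+ N by rewrite -exprD addnn mul2n.
rewrite evQM evQ_YN -!qpolyCM -[RHS]qpolyC0.
congr (qpolyC _ _); set w := (_ + _).
transitivity (u * (v ^+ 2 * w ^+ 2)); first by ring.
by rewrite v_sqr mul0r mulr0.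
Qed.

Lemma poly_qpolyCu_yX e : (e < N)%N ->
  uQ * yQ ^+ (N + e) = (cst alpha3 * (u * v)) *: map_poly cst (Y ^+ e) :> {poly A}.
Proof.
move=> lt_eN.
have -> : uQ * yQ ^+ (N + e) = qpolyC _ (cst alpha3 * (u * v)) * ev (Y ^+ e).
  by rewrite -qpolyCu_YN -mulrA -evQM -exprD evQX evQ_Y.
rewrite poly_qpolyC_evQ // (leq_trans (size_poly_exp_leq _ _)) // size_XnsubC //=.
lia.
Qed.

Lemma qpolyCu_yX_neq0 e : (e < N)%N -> uQ * yQ ^+ (N + e) != 0.
Proof.
move=> lt_eN; apply/eqP => /(congr1 (@polyn _ _)); rewrite poly_qpolyCu_yX //.
(* [Y ^+ e] is monic of degree [2 * e], so the coefficient there is [cst alpha3 * (u * v)]. *)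
move=> /(congr1 (coefp (2 * e)%N)) /=; rewrite coefZ coef_map /= coef0.
have mY : Y ^+ e \is monic by rewrite monic_exp // monicXnsubC.
have sY : (size (Y ^+ e)).-1 = (2 * e)%N.
  by rewrite size_exp size_XnsubC //= mul2n.
have := monicP mY; rewrite lead_coefE sY => ->.
rewrite rmorph1 mulr1 => /cst_uv_eq0/eqP.
by rewrite (negbTE alpha3_neq0).
Qed.

Lemma poly_wt_qpolyCu_yX e : (e < N)%N ->
  (poly_wt (uQ * yQ ^+ (N + e) : {poly A}) <= poly_wt (Y ^+ e))%N.
Proof.
move=> lt_eN; rewrite poly_qpolyCu_yX //; apply: poly_wt_leq => i Yi0.
by rewrite coefZ coef_map /= Yi0 rmorph0 mulr0.
Qed.

Section Ideal.
Variables (C : Q -> Prop) (I : nat).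
Hypothesis C_mul : forall a c, C c -> C (a * c).
Hypothesis I_least : is_least (fun k => C (uQ * yQ ^+ k)) I.

(** Either [c] or [r c] serves. The last clause keeps the annihilation by [u] when the lemma is
    applied again with [v]. *)
Lemma codeword_killed_by (r : A) (c : Q) : r ^+ 2 = 0 -> C c -> c != 0 ->
  exists c' : Q, [/\ C c', c' != 0, qpolyC _ r * c' = 0,
    (poly_wt (c' : {poly A}) <= poly_wt (c : {poly A}))%N &
    forall r', qpolyC _ r' * c = 0 -> qpolyC _ r' * c' = 0].
Proof.
move=> r2 Cc c0; have [rc0|rc0] := eqVneq (qpolyC _ r * c) 0.
  by exists c; split.
exists (qpolyC _ r * c); split=> //; first exact: C_mul.
- by rewrite mulrA -qpolyCM -expr2 r2 qpolyC0 mul0r.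
- rewrite poly_qpolyC_mul; apply: poly_wt_leq => i ci0.
  by rewrite coefZ ci0 mulr0.
- by move=> r' r'c0; rewrite mulrCA r'c0 mulr0.
Qed.

Lemma exists_socle_codeword (c : Q) : C c -> c != 0 ->
  exists d : {poly F}, [/\ d != 0, (size d <= 2 * N)%N,
    (poly_wt d <= poly_wt (c : {poly A}))%N & C (qpolyC _ (u * v) * ev d)].
Proof.
move=> Cc c0.
have [c1 [Cc1 c10 uc1 le_c1 _]] := codeword_killed_by u_sqr Cc c0.
have [c2 [Cc2 c20 vc2 le_c2 /(_ _ uc1) uc2]] := codeword_killed_by v_sqr Cc1 c10.
pose d := \poly_(i < 2 * N) soc c2`_i.
have c2E i : c2`_i = cst (soc c2`_i) * (u * v).
  by apply: socE; rewrite -coefZ -poly_qpolyC_mul ?uc2 ?vc2 coef0.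
have le_d : (size d <= 2 * N)%N := size_poly _ _.
have dE : c2 = qpolyC _ (u * v) * ev d.
  apply/val_inj; rewrite /= [RHS]poly_qpolyC_evQ //; apply/polyP => i.
  rewrite coefZ coef_map /= coef_poly mulrC; case: ltnP => [_|le_i]; first exact: c2E.
  by rewrite rmorph0 mul0r nth_default // (leq_trans (size_constacyclic _ _)).
exists d; split=> //; last by rewrite -dE.
- by apply: contraNneq c20 => d0; rewrite dE d0 /evQ !rmorph0 mulr0.
- apply: leq_trans (leq_trans le_c2 le_c1); apply: poly_wt_leq => i c2i.
  rewrite coef_poly; case: ifP => // _; apply: cst_uv_eq0.
  by rewrite -c2E.
Qed.

Lemma dvdp_socle_codeword (d : {poly F}) :
  ~ (exists b, b ^+ 2 = alpha0) -> d != 0 ->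
  C (qpolyC _ (u * v) * ev d) -> Y ^+ (I - N) %| d.
Proof.
move=> nsq d0 Cd.
have [j [e [dE cop]]] := irreducible_factor_out (irreducible_XnsubC2 nsq) d0.
suff le_IN : (I <= N + j)%N.
  by rewrite dE dvdp_mulr // dvdp_exp2l // leq_subLR.
apply: I_least.2.
(* Bezout gives [a e + b Y^(2N) = 1]. Since [u] kills [Y^(2N)], multiplying the codeword by
   [alpha3 a] yields [u y^(N + j)]. *)
have /Bezout_eq1_coprimepP[[a b] /= abE] := coprimep_expr (2 * N) cop.
have -> : uQ * yQ ^+ (N + j) =
    qpolyC _ (cst alpha3) * ev a * (qpolyC _ (u * v) * ev d).
  transitivity (uQ * ev (Y ^+ N) * ev a * ev d); last first.
    by rewrite qpolyCu_YN qpolyCM; ring.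
  rewrite dE -evQ_Y -evQX -!mulrA -!evQM.
  have -> : Y ^+ N * (a * (Y ^+ j * e)) =
      Y ^+ (N + j) + - (Y ^+ (2 * N) * (b * Y ^+ (N + j))).
    by rewrite exprD -[X in _ = X + _]mulr1 -abE; ring.
  by rewrite evQD evQN [ev (Y ^+ (2 * N) * _)]evQM mulrDr mulrN mulrA
    qpolyCu_Y2N mul0r subr0.
exact: C_mul.
Qed.

(** Common frame for both cases of the formula: [u y^(N + e)] attains the weight [w], and multiples
    of [Y ^+ (I - N)] bound all codewords from below. *)
Lemma hamming_distance_ideal e w :
  ~ (exists b, b ^+ 2 = alpha0) -> (e < N)%N -> (I <= N + e)%N ->
  (poly_wt (Y ^+ e) <= w)%N ->
  (forall d : {poly F}, d != 0 -> (size d <= 2 * N)%N -> Y ^+ (I - N) %| d ->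
     (w <= poly_wt d)%N) ->
  hamming_distance C w.
Proof.
move=> nsq lt_eN le_I le_Ye w_le.
have C_ge c : C c -> c != 0 -> (w <= hamming_weight (codeword c))%N.
  move=> Cc c0; have [d [d0 le_d le_wt Cd]] := exists_socle_codeword Cc c0.
  rewrite hamming_weight_codeword //; apply: leq_trans le_wt.
  exact: w_le d0 le_d (dvdp_socle_codeword nsq d0 Cd).
split=> [|k [c [Cc c0 <-]]]; last exact: C_ge.
have c0 := qpolyCu_yX_neq0 lt_eN; pose c := uQ * yQ ^+ (N + e).
have Cc : C c.
  rewrite /c -(subnKC le_I) exprD mulrA mulrC.
  exact/C_mul/I_least.1.
exists c; split=> //; apply/eqP; rewrite eqn_leq C_ge // andbT.
rewrite hamming_weight_codeword //; apply: leq_trans le_Ye.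
exact: poly_wt_qpolyCu_yX.
Qed.

End Ideal.

End Code.

(** A root [b] of [alpha0] gives the root [b1 = b ^+ (p ^ s)] of [alpha1]. As [v^2 = 0], it lifts to
    the root [b1 + w v] of [alpha] with [w = (alpha3 + alpha4 u) / (2 b1)], where 2 is invertible
    because [p] is odd. *)
Lemma alpha0_nonsquare (p s : nat) (F : fieldType) (A : comNzRingType)
    (cst : {rmorphism F -> A}) (u v : A) (alpha0 alpha1 alpha3 alpha4 : F) :
  p \in [pchar F] -> odd p -> v ^+ 2 = 0 ->
  alpha1 != 0 -> alpha0 ^+ (p ^ s) = alpha1 ->
  ~ (exists beta : A,
       beta ^+ 2 = cst alpha1 + cst alpha3 * v + cst alpha4 * (u * v)) ->
  ~ exists b, b ^+ 2 = alpha0.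
Proof.
move=> pcharF p_odd v2 alpha1_neq0 alpha0E nsq [b bE]; apply: nsq.
pose b1 := b ^+ (p ^ s).
have b1E : b1 ^+ 2 = alpha1 by rewrite -alpha0E -bE -!exprM mulnC.
have b10 : b1 != 0 by apply: contraNneq alpha1_neq0 => b10; rewrite -b1E b10 expr0n.
have two0 : 2%:R != 0 :> F.
  rewrite -(dvdn_pcharf pcharF); apply/negP => /(dvdn_leq (ltn0Sn 1)) le_p2.
  have p2 : p = 2%N.
    by apply/eqP; rewrite eqn_leq le_p2 prime_gt1 ?(pcharf_prime pcharF).
  by move: p_odd; rewrite p2.
have b20 : 2%:R * b1 != 0 by rewrite mulf_neq0.
pose half a := a / (2%:R * b1).
have halfE a : cst a = cst b1 * cst (half a) *+ 2.
  by rewrite -rmorphM -rmorphMn; congr (cst _); rewrite /half; field; apply/andP.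
exists (cst b1 + (cst (half alpha3) + cst (half alpha4) * u) * v).
rewrite (halfE alpha3) (halfE alpha4) -b1E rmorphXn.
rewrite sqrrD exprMn v2 mulr0 addr0; ring.
Qed.

(** Here [k = Gam - 1], [c = gam] and [n = s - gam - 1]. The witness [e] makes [p ^ s + e] the upper
    end of the range, and the last conjunct is what the lower bound on weights requires of
    [I - p ^ s]. *)
Lemma exponent_of_range p n c k i : (1 < p)%N -> (k.+1 < p)%N ->
  (2 * p ^ (c + n).+1 - p ^ n.+1 + k * p ^ n < i)%N ->
  (i <= 2 * p ^ (c + n).+1 - p ^ n.+1 + k.+1 * p ^ n)%N ->
  exists e, [/\ (e + p ^ n.+1 = p ^ (c + n).+1 + k.+1 * p ^ n)%N,
    (e < p ^ (c + n).+1)%N, (i <= p ^ (c + n).+1 + e)%N &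
    (p ^ (c + n).+1 + k * p ^ n < i - p ^ (c + n).+1 + p ^ n.+1)%N].
Proof.
move=> p_gt1 lt_kp.
have pn_gt0 : (0 < p ^ n)%N by rewrite expn_gt0 ltnW.
have le_pn : (p ^ n.+1 <= p ^ (c + n).+1)%N by rewrite leq_exp2l // ltnS leq_addl.
have lt_kpn : (k.+1 * p ^ n < p ^ n.+1)%N by rewrite expnS ltn_mul2r pn_gt0.
exists (p ^ (c + n).+1 - p ^ n.+1 + k.+1 * p ^ n)%N; split; lia.
Qed.

Theorem theorem4p6 (p m s : nat) (F : finFieldType)
    (p_prime : prime p) (p_odd : odd p) (m_gt0 : (0 < m)%N) (s_gt0 : (0 < s)%N)
    (cardF : #|F| = (p ^ m)%N)
    (alpha1 alpha3 alpha4 : F)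
    (alpha1_neq0 : alpha1 != 0) (alpha3_neq0 : alpha3 != 0)
    (alpha4_neq0 : alpha4 != 0)
    (alpha : baseR F)
    (alphaE : alpha = cstR alpha1 + cstR alpha3 * vR F
                      + cstR alpha4 * (uR F * vR F))
    (alpha_nonsquare : ~ exists beta : baseR F, beta ^+ 2 = alpha)
    (alpha0 : F) (alpha0E : alpha0 ^+ (p ^ s) = alpha1)
    (l t : nat) (l_le : (l <= 2 * p ^ s - 1)%N) (t_lt : (t < l)%N)
    (z : constacyclic_ring (2 * p ^ s) alpha) (z_spec : zero_or_unit alpha0 z)
    (C : constacyclic_ring (2 * p ^ s) alpha -> Prop)
    (CE : C = principal_ideal (yA (2 * p ^ s) alpha alpha0 ^+ l
            + uA (2 * p ^ s) alpha * yA (2 * p ^ s) alpha alpha0 ^+ t * z))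
    (I : nat)
    (I_least : is_least (fun k =>
       C (uA (2 * p ^ s) alpha * yA (2 * p ^ s) alpha alpha0 ^+ k)) I) :
  ((I <= p ^ s)%N -> hamming_distance C 1) /\
  (forall Gam gam : nat,
     (1 <= Gam <= p - 1)%N -> (gam <= s - 1)%N ->
     (2 * p ^ s - p ^ (s - gam) + (Gam - 1) * p ^ (s - gam - 1) + 1 <= I)%N ->
     (I <= 2 * p ^ s - p ^ (s - gam) + Gam * p ^ (s - gam - 1))%N ->
     hamming_distance C ((Gam + 1) * p ^ gam)%N).
Proof.
have pcharF : p \in [pchar F] by apply: card_finPcharP cardF p_prime.
have nsq : ~ exists b, b ^+ 2 = alpha0.
  apply: (@alpha0_nonsquare _ _ _ _ (@cstR F) (uR F) _ _ _ alpha3 alpha4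
    pcharF p_odd (@vR_sqr F) alpha1_neq0 alpha0E).
  by rewrite -alphaE.
have C_mul a c : C c -> C (a * c).
  by rewrite CE => -[b ->]; exists (a * b); rewrite mulrA.
have dist := hamming_distance_ideal pcharF (@uR_sqr F) (@vR_sqr F)
  (@uvR_mulC_eq0 F) (@socleE F) alpha3_neq0 alpha0E alphaE C_mul I_least nsq.
have p_gt0 := prime_gt0 p_prime.
have alpha0_neq0 : alpha0 != 0.
  by apply: contraNneq alpha1_neq0 => a0;
    rewrite -alpha0E a0 expr0n -leqn0 leqNgt expn_gt0 p_gt0.
split=> [le_I | Gam gam /andP[Gam_gt0 le_Gam] le_gam].
  (* With [e = 0] the codeword is the constant [alpha3 u v], of weight one. *)
  apply: (dist 0%N); rewrite ?expn_gt0 ?p_gt0 ?addn0 //.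
    by rewrite expr0 leq_poly_wt_size ?size_poly1.
  by move=> d d0 _ _; apply: poly_wt_gt0.
have [n sE] : exists n, s = (gam + n).+1.
  exists (s - gam.+1)%N; rewrite -addSn subnKC //.
  by move: le_gam; rewrite -ltnS subn1 prednK.
have nE : (s - gam = n.+1)%N by rewrite sE -addnS addKn.
rewrite nE (subn1 n.+1) /=; case: Gam Gam_gt0 le_Gam => // k _.
rewrite subn1 -ltnS prednK // subn1 !addn1 => lt_kp ge_I le_I.
rewrite sE in ge_I le_I.
have [e [eE lt_e le_Ie lt_I]] :=
  exponent_of_range (prime_gt1 p_prime) lt_kp ge_I le_I.
rewrite -sE in lt_e le_Ie; apply: (dist e) => //.
  exact: poly_wt_quadratic_le eE.
move=> d d0 le_d dvd_d; rewrite sE in le_d dvd_d.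
exact: (poly_wt_quadratic_ge pcharF alpha0_neq0 d0 le_d dvd_d lt_I).
Qed.
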